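(* Let $P$ be a monoid, let $\Lambda$ be a $P$-graph, and let $m,n\in P$. Then $(m,n)\in\Sigma_\Lambda$ if and only if $m-n\in\operatorname{Per}\Lambda$.
   Context: All monoids are finitely generated, cancellative and abelian; $P$ is embedded in its Grothendieck group $\mathcal{G}(P)$ and is also regarded as a category with one object. A $P$-graph is a countable small category $\Lambda$ (identified with its set of morphisms) with a functor $d:\Lambda\to P$ satisfying the factorization property: whenever $d(\xi)=p+q$ there are unique $\eta,\zeta\in\Lambda$ with $d(\eta)=p$, $d(\zeta)=q$, $\xi=\eta\zeta$. $\Lambda^p=d^{-1}(p)$, $\Lambda^0$ is the vertex set, $r,s:\Lambda\to\Lambda^0$ are the range and source maps. All $P$-graphs are assumed row-finite and source-free: $0<|\{\xi\in\Lambda^p:r(\xi)=v\}|<\infty$ for all $v\in\Lambda^0$, $p\in P$. $\Omega_P=\{(p,q)\in P\times P: q-p\in P\}$ is the $P$-graph with $d(p,q)=q-p$, $s(p,q)=q$, $r(p,q)=p$. An infinite path of $\Lambda$ is a degree-preserving functor $x:\Omega_P\to\Lambda$; $\Lambda^\infty$ is the set of these, and $v\Lambda^\infty$ the set of those with range $x(0,0)=v$. For $p\in P$, $\sigma^p(x)(q,r)=x(p+q,p+r)$. For $\mu\in\Lambda$ and $x\in s(\mu)\Lambda^\infty$, $\mu x$ is the unique infinite path with $(\mu x)(0,p)=\mu\cdot x(0,p-d(\mu))$ for all $p\in P$ with $p-d(\mu)\in P$. The equivalence relation $\sim$ on $\Lambda$: $\xi\sim\eta$ iff $s(\xi)=s(\eta)$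 and $\xi x=\eta x$ for all $x\in s(\xi)\Lambda^\infty$. $\operatorname{Per}\Lambda=\{d(\xi)-d(\eta):\xi,\eta\in\Lambda,\ \xi\sim\eta\}\subseteq\mathcal{G}(P)$. For $v\in\Lambda^0$, $\Sigma_v=\{(m,n)\in P\times P:\sigma^m(x)=\sigma^n(x)\text{ for all }x\in v\Lambda^\infty\}$, and $\Sigma_\Lambda=\bigcup_{v\in\Lambda^0}\Sigma_v$. *)

(* Defs.v *)
From HB Require Import structures.
From mathcomp Require Import all_boot all_order all_algebra generic_quotient.
From mathcomp Require Import boolp classical_sets functions cardinality.

Set Implicit Arguments.
Unset Strict Implicit.
Unset Printing Implicit Defensive.

Import GRing.Theory.
Local Open Scope ring_scope.
Local Open Scope quotient_scope.
Local Open Scope classical_set_scope.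

HB.mixin Record isFgCancellative P of GRing.Nmodule P := {
  addpI : forall p : P, injective (+%R p);
  fg_gens : exists gs : seq P, forall p : P,
    exists c : 'I_(size gs) -> nat, p = \sum_(i < size gs) gs`_i *+ c i
}.

#[short(type="fgcMonoidType")]
HB.structure Definition FgcMonoid := {P of isFgCancellative P & GRing.Nmodule P}.

Lemma addIp (P : fgcMonoidType) (p : P) : injective (+%R^~ p).
Proof. by move=> a b; rewrite addrC [X in _ = X]addrC => /addpI. Qed.

(** The Grothendieck group: formal differences [u.1 - u.2], with [u] and [w]
    identified when [u.1 + w.2 = w.1 + u.2]. *)

Section Grothendieck.
Variable P : fgcMonoidType.

Definition groth_rel (u w : P * P) : bool := u.1 + w.2 == w.1 + u.2.

Lemma groth_rel_refl : reflexive groth_rel.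
Proof. by move=> u; exact: eqxx. Qed.

Lemma groth_rel_sym : symmetric groth_rel.
Proof. by move=> u w; exact: eq_sym. Qed.

Lemma groth_rel_trans : transitive groth_rel.
Proof.
move=> [b b'] [a a'] [c c']; rewrite /groth_rel /= => /eqP ab /eqP bc.
by apply/eqP/(@addIp _ b'); rewrite addrAC ab addrAC bc addrAC.
Qed.

Canonical groth_equiv :=
  EquivRel groth_rel groth_rel_refl groth_rel_sym groth_rel_trans.

Definition groth := {eq_quot groth_rel}.
HB.instance Definition _ : EqQuotient _ groth_rel groth := EqQuotient.on groth.
HB.instance Definition _ := Choice.on groth.

Definition grdiff (a b : P) : groth := \pi_groth (a, b).

Lemma grdiff_eq (a b c e : P) : grdiff a b = grdiff c e <-> a + e = c + b.
Proof.
rewrite /grdiff; split => [/eqmodP /eqP//|H].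
by apply/eqmodP/eqP.
Qed.

Lemma grdiffE (g : groth) : g = grdiff (repr g).1 (repr g).2.
Proof. by rewrite /grdiff -surjective_pairing reprK. Qed.

Definition groth_add (g h : groth) : groth :=
  grdiff ((repr g).1 + (repr h).1) ((repr g).2 + (repr h).2).
Definition groth_opp (g : groth) : groth := grdiff (repr g).2 (repr g).1.

Lemma groth_addE a b c e :
  groth_add (grdiff a b) (grdiff c e) = grdiff (a + c) (b + e).
Proof.
apply/grdiff_eq.
have /grdiff_eq E1 := grdiffE (grdiff a b).
have /grdiff_eq E2 := grdiffE (grdiff c e).
by rewrite addrACA -E1 -E2 addrACA.
Qed.

Lemma groth_oppE a b : groth_opp (grdiff a b) = grdiff b a.
Proof.
apply/grdiff_eq; have /grdiff_eq E := grdiffE (grdiff a b).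
by rewrite addrC E addrC.
Qed.

Lemma groth_addA : associative groth_add.
Proof.
move=> g h k; rewrite (grdiffE g) (grdiffE h) (grdiffE k).
by rewrite !groth_addE !addrA.
Qed.

Lemma groth_addC : commutative groth_add.
Proof.
move=> g h; rewrite (grdiffE g) (grdiffE h) !groth_addE.
by congr grdiff; rewrite addrC.
Qed.

Lemma groth_add0 : left_id (grdiff 0 0) groth_add.
Proof. by move=> g; rewrite (grdiffE g) groth_addE !add0r. Qed.

Lemma groth_addN : left_inverse (grdiff 0 0) groth_opp groth_add.
Proof.
move=> g; rewrite (grdiffE g) groth_oppE groth_addE.
by apply/grdiff_eq; rewrite addr0 add0r addrC.
Qed.

HB.instance Definition _ :=
  GRing.isZmodule.Build groth groth_addA groth_addC groth_add0 groth_addN.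

Definition togroth (p : P) : groth := grdiff p 0.

Lemma togroth0 : togroth 0 = 0. Proof. by []. Qed.

Lemma togrothD (p q : P) : togroth (p + q) = togroth p + togroth q.
Proof. by rewrite /togroth [RHS]groth_addE addr0. Qed.

Lemma togroth_inj : injective togroth.
Proof. by move=> p q /grdiff_eq; rewrite !addr0. Qed.

Lemma grdiffB (a b : P) : grdiff a b = togroth a - togroth b.
Proof. by rewrite [- _]groth_oppE [RHS]groth_addE addr0 add0r. Qed.

Lemma togrothB_eq (p q r : P) :
  togroth q - togroth p = togroth r <-> q = p + r.
Proof. by rewrite -grdiffB grdiff_eq addr0 addrC. Qed.

End Grothendieck.

(** Small categories identified with their sets of morphisms: [rng x] and
    [src x] are the identity morphisms at the range and at the source of [x].
    Composition is written in functional order: [comp x y] is the composite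
    [xy], which is meaningful only if [src x = rng y]. *)

Record smallCat := SmallCat {
  mor :> Type;
  rng : mor -> mor;
  src : mor -> mor;
  comp : mor -> mor -> mor;
  rng_rng : forall x, rng (rng x) = rng x;
  src_rng : forall x, src (rng x) = rng x;
  rng_src : forall x, rng (src x) = src x;
  src_src : forall x, src (src x) = src x;
  rng_comp : forall x y, src x = rng y -> rng (comp x y) = rng x;
  src_comp : forall x y, src x = rng y -> src (comp x y) = src y;
  comp_rng : forall x, comp (rng x) x = x;
  comp_src : forall x, comp x (src x) = x;
  compA : forall x y z, src x = rng y -> src y = rng z ->
    comp x (comp y z) = comp (comp x y) z
}.

Record functor (C D : smallCat) := Functor {
  fun_of_functor :> C -> D;
  functor_rng : forall x, fun_of_functor (rng x) = rng (fun_of_functor x);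
  functor_src : forall x, fun_of_functor (src x) = src (fun_of_functor x);
  functor_comp : forall x y, src x = rng y ->
    fun_of_functor (comp x y) = comp (fun_of_functor x) (fun_of_functor y)
}.

Lemma functor_eq (C D : smallCat) (F G : functor C D) :
  (forall x, F x = G x) -> F = G.
Proof.
case: F G => [f f1 f2 f3] [g g1 g2 g3] /= fg.
have {}fg : f = g by apply/funext.
by case: _ / fg in g1 g2 g3 *; congr Functor; exact: Prop_irrelevance.
Qed.

Definition functor_compose (C D E : smallCat) (G : functor D E)
  (F : functor C D) : functor C E.
Proof.
refine (@Functor C E (fun x => G (F x)) _ _ _).
- by move=> x; rewrite 2!functor_rng.
- by move=> x; rewrite 2!functor_src.
- move=> x y xy; rewrite (functor_comp F xy); apply: functor_comp.
  by rewrite -functor_src xy functor_rng.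
Defined.

(** The monoid [P] regarded as a category with one object. *)
Definition oneObj (P : nmodType) : smallCat.
Proof.
refine (@SmallCat P (fun=> 0) (fun=> 0) +%R _ _ _ _ _ _ _ _ _) => //.
- by move=> x; exact: add0r.
- by move=> x; exact: addr0.
- by move=> x y z _ _; exact: addrA.
Defined.

(** Row-finiteness and source-freeness are part of the structure. *)
Record pgraph (P : fgcMonoidType) := PGraph {
  pcat :> smallCat;
  pgraph_countable : countable [set: pcat];
  deg : functor pcat (oneObj P);
  factorization : forall (xi : pcat) (p q : P), deg xi = p + q ->
    exists! ez : pcat * pcat,
      [/\ deg ez.1 = p, deg ez.2 = q, src ez.1 = rng ez.2
        & xi = comp ez.1 ez.2];
  row_finite : forall (v : pcat) (p : P), deg v = 0 ->
    finite_set [set xi : pcat | deg xi = p /\ rng xi = v];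
  source_free : forall (v : pcat) (p : P), deg v = 0 ->
    [set xi : pcat | deg xi = p /\ rng xi = v] !=set0
}.

(** The vertex set [L^0].  By factorization, the morphisms of degree [0] are
    exactly the identities; see [deg_rng] and [vertexE]. *)
Definition vertices (P : fgcMonoidType) (L : pgraph P) : set L :=
  [set v : L | deg L v = 0].
Arguments vertices {P} L _ /.

Section Omega.
Variable P : fgcMonoidType.

(** The pairs [(p, q)] with [q - p] in [P]; see [togrothB_eq]. *)
Record omega := Om { om1 : P; om2 : P; omP : exists r, om2 = om1 + r }.

Lemma omega_eq (x y : omega) : om1 x = om1 y -> om2 x = om2 y -> x = y.
Proof.
case: x y => [p q h] [p' q' h'] /= e1 e2; move: h h'; rewrite e1 e2 => h h'.
by congr Om; exact: Prop_irrelevance.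
Qed.

Lemma om_refl (p : P) : exists r, p = p + r.
Proof. by exists 0; rewrite addr0. Qed.

Lemma om_trans (p q t : P) :
  (exists r, q = p + r) -> (exists r, t = q + r) -> exists r, t = p + r.
Proof. by move=> [r ->] [r' ->]; exists (r + r'); rewrite addrA. Qed.

Definition om_id (p : P) : omega := Om (om_refl p).

Definition om_comp (x y : omega) : omega :=
  match pselect (om2 x = om1 y) with
  | left e => @Om (om1 x) (om2 y)
      (om_trans (omP x) (eq_ind_r (fun q => exists r, om2 y = q + r) (omP y) e))
  | right _ => x
  end.

Lemma om_comp1 x y : om1 (om_comp x y) = om1 x.
Proof. by rewrite /om_comp; case: pselect. Qed.

Lemma om_comp2 x y : om2 x = om1 y -> om2 (om_comp x y) = om2 y.
Proof. by rewrite /om_comp; case: pselect. Qed.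

Definition omegaCat : smallCat.
Proof.
refine (@SmallCat omega (fun x => om_id (om1 x)) (fun x => om_id (om2 x))
  om_comp _ _ _ _ _ _ _ _ _) => //.
- by move=> x y _; apply: omega_eq; rewrite /= om_comp1.
- by move=> x y [e _]; apply: omega_eq; rewrite /= om_comp2.
- by move=> x; apply: omega_eq; rewrite ?om_comp1 ?om_comp2.
- by move=> x; apply: omega_eq; rewrite ?om_comp1 ?om_comp2.
- move=> x y z [exy _] [eyz _].
  by apply: omega_eq; rewrite ?om_comp1 ?om_comp2 ?om_comp1 ?om_comp2.
Defined.

Lemma om_src_rng (x y : omegaCat) : src x = rng y <-> om2 x = om1 y.
Proof. by split=> [[]//|e]; apply: omega_eq. Qed.

Definition om_diff (x : omega) : P := sval (cid (omP x)).

Lemma om_diffP x : om2 x = om1 x + om_diff x.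
Proof. exact: (svalP (cid (omP x))). Qed.

Lemma om_diff_uniq x r : om2 x = om1 x + r -> om_diff x = r.
Proof. by rewrite om_diffP => /addpI. Qed.

Definition omegaDeg : functor omegaCat (oneObj P).
Proof.
refine (@Functor omegaCat (oneObj P) om_diff _ _ _).
- by move=> x; apply: om_diff_uniq; rewrite /= addr0.
- by move=> x; apply: om_diff_uniq; rewrite /= addr0.
- move=> x y /om_src_rng e; apply: om_diff_uniq.
  by rewrite /= om_comp1 om_comp2// om_diffP -e om_diffP addrA.
Defined.

Lemma fgc_countable : countable [set: P].
Proof.
have [gs gsP] := @fg_gens P.
pose f (c : seq nat) : P := \sum_(i < size gs) gs`_i *+ nth 0%N c i.
have -> : [set: P] = f @` [set: seq nat].
  apply/seteqP; split=> // p _; have [c ->] := gsP p.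
  exists (mkseq (fun j => oapp c 0%N (insub j)) (size gs)) => //.
  by apply: eq_bigr => i _; rewrite nth_mkseq// valK.
exact/(sub_countable (card_image_le _ _))/countableP.
Qed.

Lemma omega_countable : countable [set: omega].
Proof.
have : countable [set: P * P].
  by rewrite -setXTT; apply: countableX; exact: fgc_countable.
move=> /countable_injP[f f_inj]; apply/countable_injP.
exists (fun x : omega => f (om1 x, om2 x)) => x y _ _ /f_inj.
by rewrite !in_setT => /(_ isT isT)[e1 e2]; exact: omega_eq.
Qed.

Lemma omega_factorization (x : omegaCat) (p q : P) : omegaDeg x = p + q ->
  exists! ez : omegaCat * omegaCat,
    [/\ omegaDeg ez.1 = p, omegaDeg ez.2 = q, src ez.1 = rng ez.2
      & x = comp ez.1 ez.2].
Proof.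
move=> dx; have x2 : om2 x = om1 x + p + q by rewrite om_diffP [om_diff x]dx addrA.
pose e : omega := @Om (om1 x) (om1 x + p) (ex_intro _ p erefl).
pose z : omega := @Om (om1 x + p) (om2 x) (ex_intro _ q x2).
exists (e, z); split.
  split=> /=.
  - exact: om_diff_uniq.
  - exact: om_diff_uniq.
  - exact: omega_eq.
  - by apply: omega_eq; rewrite ?om_comp1 ?om_comp2.
move=> [e' z'] /= [de dz /om_src_rng ez E].
have e2 : om2 e' = om1 e' + p by rewrite om_diffP [om_diff e']de.
have x1 : om1 x = om1 e' by rewrite E om_comp1.
have x3 : om2 x = om2 z' by rewrite E om_comp2.
by congr pair; apply: omega_eq; rewrite /= ?x1 ?x3 -?ez.
Qed.

Lemma omega_row (v : omegaCat) (p : P) : omegaDeg v = 0 ->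
  [set x : omegaCat | omegaDeg x = p /\ rng x = v] =
  [set @Om (om1 v) (om1 v + p) (ex_intro _ p erefl)].
Proof.
move=> dv; have v2 : om2 v = om1 v by rewrite om_diffP [om_diff v]dv addr0.
apply/seteqP; split=> x /=.
  by move=> [dx <-]; apply: omega_eq => //=; rewrite om_diffP [om_diff x]dx.
by move=> ->; split; [exact: om_diff_uniq|exact: omega_eq].
Qed.

Definition Omega : pgraph P.
Proof.
refine (@PGraph P omegaCat omega_countable omegaDeg omega_factorization _ _).
- by move=> v p dv; rewrite omega_row//; exact: finite_set1.
- by move=> v p dv; rewrite omega_row//; eexists.
Defined.

Definition om0 (p : P) : Omega := @Om 0 p (ex_intro _ p (esym (add0r p))).

Lemma om_shiftP (p : P) (x : omega) : exists r, p + om2 x = p + om1 x + r.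
Proof. by exists (om_diff x); rewrite om_diffP addrA. Qed.

(** The functor [(q, r) |-> (p + q, p + r)] on [Omega]. *)
Definition om_shift (p : P) : functor Omega Omega.
Proof.
refine (@Functor Omega Omega (fun x => Om (om_shiftP p x)) _ _ _).
- by move=> x; exact: omega_eq.
- by move=> x; exact: omega_eq.
- move=> x y xy; have e := (om_src_rng x y).1 xy.
  have e' : om2 (Om (om_shiftP p x)) = om1 (Om (om_shiftP p y)) by rewrite /= e.
  by apply: omega_eq; rewrite /= !(om_comp1, om_comp2).
Defined.

Lemma deg_om_shift p (x : Omega) : deg Omega (om_shift p x) = deg Omega x.
Proof. by apply: om_diff_uniq; rewrite /= -addrA -om_diffP. Qed.

End Omega.

Section InfinitePaths.
Variables (P : fgcMonoidType) (L : pgraph P).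
Implicit Types (p q : P) (v xi eta mu : L).

Record ipath := IPath {
  ipath_functor :> functor (Omega P) L;
  ipath_deg : forall w, deg L (ipath_functor w) = deg (Omega P) w
}.

Lemma ipath_eq (x y : ipath) : (forall w, x w = y w) -> x = y.
Proof.
case: x y => [x dx] [y dy] /= xy.
have {}xy : x = y by exact: functor_eq.
by case: _ / xy in dy *; congr IPath; exact: Prop_irrelevance.
Qed.

Definition irng (x : ipath) : L := x (om0 0).

(** [sigma p x (q, r) = x (p + q, p + r)] *)
Definition sigma (p : P) (x : ipath) : ipath :=
  @IPath (functor_compose x (om_shift p))
    (fun w => etrans (ipath_deg x (om_shift p w)) (deg_om_shift p w)).

Lemma deg_rng xi : deg L (rng xi) = 0.
Proof. by rewrite functor_rng. Qed.

Lemma deg_src xi : deg L (src xi) = 0.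
Proof. by rewrite functor_src. Qed.

Lemma deg_comp xi eta : src xi = rng eta ->
  deg L (comp xi eta) = deg L xi + deg L eta.
Proof. by move=> e; rewrite functor_comp. Qed.

Lemma factor_uniq (e z e' z' : L) :
  src e = rng z -> src e' = rng z' -> deg L e = deg L e' ->
  deg L z = deg L z' -> comp e z = comp e' z' -> e = e' /\ z = z'.
Proof.
move=> ez ez' de dz E.
have [[a b] [_ U]] := factorization (deg_comp ez).
have U1 := U (e, z) (And4 erefl erefl ez erefl).
have U2 := U (e', z') (And4 (esym de) (esym dz) ez' E).
by move: U1; rewrite U2 => -[-> ->].
Qed.

Lemma vertexE v : deg L v = 0 -> rng v = v /\ src v = v.
Proof.
move=> dv; have [] := @factor_uniq (rng v) v v (src v).
- exact: src_rng.
- by rewrite rng_src.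
- by rewrite deg_rng.
- by rewrite deg_src.
- by rewrite comp_rng comp_src.
by move=> h1 h2; split.
Qed.

Lemma rng_ipath0 (x : ipath) p : rng (x (om0 p)) = irng x.
Proof. by rewrite -functor_rng; congr (x _); exact: omega_eq. Qed.

Lemma deg_ipath0 (x : ipath) p : deg L (x (om0 p)) = p.
Proof. by rewrite ipath_deg; apply: om_diff_uniq; rewrite /= add0r. Qed.

Lemma om0_comp (w : Omega P) :
  src (om0 (om1 w)) = rng w /\ om0 (om2 w) = comp (om0 (om1 w)) w.
Proof.
by split; [exact: omega_eq|apply: omega_eq; rewrite /= ?om_comp1 ?om_comp2].
Qed.

Lemma ipath_comp0 (x : ipath) (w : Omega P) :
  src (x (om0 (om1 w))) = rng (x w) /\
  x (om0 (om2 w)) = comp (x (om0 (om1 w))) (x w).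
Proof.
have [e ->] := om0_comp w; split; last exact: functor_comp.
by rewrite -functor_src e functor_rng.
Qed.

(** [y] satisfies the equations defining the infinite path [mu x]; here
    [r = p - d(mu)]. *)
Definition is_prepend mu (x y : ipath) : Prop :=
  forall p r, p = deg L mu + r -> y (om0 p) = comp mu (x (om0 r)).

Lemma is_prepend_uniq mu (x y y' : ipath) :
  is_prepend mu x y -> is_prepend mu x y' -> y = y'.
Proof.
move=> Hy Hy'.
have E0 p : y (om0 p) = y' (om0 p).
  pose w : Omega P := @Om P p (deg L mu + p) (ex_intro _ (deg L mu) (addrC _ _)).
  have [e1 c1] := ipath_comp0 y w; have [e2 c2] := ipath_comp0 y' w.
  have [] // := factor_uniq e1 e2.
  - by rewrite !deg_ipath0.
  - by rewrite !ipath_deg.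
  - by rewrite -c1 -c2 (Hy _ p)// (Hy' _ p).
apply: ipath_eq => w.
have [e1 c1] := ipath_comp0 y w; have [e2 c2] := ipath_comp0 y' w.
have [] // := factor_uniq e1 e2.
- by rewrite E0.
- by rewrite !ipath_deg.
- by rewrite -c1 -c2 E0.
Qed.

Lemma is_prepend_ex mu (x : ipath) : irng x = src mu ->
  exists y, is_prepend mu x y.
Proof.
move=> xmu; set a := deg L mu.
pose M q := comp mu (x (om0 q)).
have cM q : src mu = rng (x (om0 q)) by rewrite rng_ipath0.
have dM q : deg L (M q) = q + a by rewrite /M deg_comp// deg_ipath0 addrC.
have ini q : exists z : L, deg L z = q /\
    exists k, [/\ deg L k = a, src z = rng k & M q = comp z k].
  have [[z k] [[/= dz dk zk E] _]] := factorization (dM q).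
  by exists z; split=> //; exists k.
pose Z q := sval (cid (ini q)).
have dZ q : deg L (Z q) = q by have [] := svalP (cid (ini q)).
have kZ q : exists k, [/\ deg L k = a, src (Z q) = rng k & M q = comp (Z q) k].
  by have [] := svalP (cid (ini q)).
have seg (w : Omega P) : exists z : L,
    [/\ deg L z = deg _ w, src (Z (om1 w)) = rng z
      & Z (om2 w) = comp (Z (om1 w)) z].
  have dw : deg L (Z (om2 w)) = om1 w + deg _ w by rewrite dZ om_diffP.
  have [[e z] [[/= de dz ez E] _]] := factorization dw.
  exists z; suff <- : e = Z (om1 w) by split.
  have [k [dk zk Mk]] := kZ (om2 w); have [k' [dk' zk' Mk']] := kZ (om1 w).
  have [cx Ex] := ipath_comp0 x w.
  have szk : src z = rng k by rewrite -zk E src_comp.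
  have sk' : src k' = rng (x w).
    by rewrite -cx -(src_comp zk') -Mk' /M src_comp.
  have [] // := @factor_uniq e (comp z k) (Z (om1 w)) (comp k' (x w)).
  - by rewrite rng_comp.
  - by rewrite rng_comp.
  - by rewrite de dZ.
  - by rewrite !deg_comp// dz dk dk' ipath_deg addrC.
  - rewrite !compA// -E -Mk -Mk' /M Ex compA//.
pose Y w := sval (cid (seg w)).
have dY w : deg L (Y w) = deg _ w by have [] := svalP (cid (seg w)).
have rY w : src (Z (om1 w)) = rng (Y w) by have [] := svalP (cid (seg w)).
have ZY w : Z (om2 w) = comp (Z (om1 w)) (Y w).
  by have [] := svalP (cid (seg w)).
have sY w : src (Z (om2 w)) = src (Y w) by rewrite ZY src_comp.
have uY (w : Omega P) (z : L) : deg L z = deg _ w -> src (Z (om1 w)) = rng z ->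
    Z (om2 w) = comp (Z (om1 w)) z -> Y w = z.
  move=> dz rz E; have [] // := factor_uniq (rY w) rz.
  - by rewrite dY.
  - by rewrite -ZY.
have idY p : Y (om_id p) = src (Z p).
  apply: uY.
  - by rewrite deg_src; apply/esym/om_diff_uniq; rewrite /= addr0.
  - by rewrite rng_src.
  - by rewrite comp_src.
have Y1 (w : Omega P) : Y (rng w) = rng (Y w) by rewrite idY rY.
have Y2 (w : Omega P) : Y (src w) = src (Y w) by rewrite idY sY.
have Y3 (w w' : Omega P) : src w = rng w' -> Y (comp w w') = comp (Y w) (Y w').
  move=> ww'; have e := (om_src_rng w w').1 ww'.
  have cY : src (Y w) = rng (Y w') by rewrite -Y2 ww' Y1.
  apply: uY.
  - by rewrite deg_comp// !dY (functor_comp (deg (Omega P)) ww').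
  - by rewrite om_comp1 rng_comp// rY.
  - by rewrite om_comp1 om_comp2// ZY -e ZY compA.
exists (IPath (ipath_functor := @Functor (Omega P) L Y Y1 Y2 Y3) dY).
move=> p r ->{p} /=; apply: uY => /=.
- rewrite deg_comp// deg_ipath0; apply/esym/om_diff_uniq.
  by rewrite /= add0r.
- have [z0 _] := vertexE (dZ 0).
  have [_ ->] := vertexE (dZ 0).
  have [k [dk zk Mk]] := kZ 0.
  by rewrite rng_comp// -z0 -(rng_comp zk) -Mk /M rng_comp.
have [k [dk zk Mk]] := kZ (deg L mu + r).
pose w : Omega P := @Om P r (deg L mu + r) (ex_intro _ (deg L mu) (addrC _ _)).
have [cx Ex] := ipath_comp0 x w.
have dxw : deg L (x w) = a.
  by rewrite ipath_deg; apply: om_diff_uniq; rewrite /= addrC.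
have [] // := @factor_uniq _ _ (comp mu (x (om0 r))) (x w) zk.
- by rewrite src_comp.
- by rewrite dZ deg_comp// deg_ipath0.
- by rewrite dk dxw.
- by rewrite -Mk /M Ex compA.
move=> -> _.
have [k0 [_ zk0 Mk0]] := kZ 0.
have [z0 _] := vertexE (dZ 0).
rewrite -{1}(comp_rng (comp _ _)); congr comp.
by rewrite rng_comp// -z0 -(rng_comp zk0) -Mk0 /M rng_comp.
Qed.

(** The infinite path [mu x]; it is unique by [is_prepend_uniq]. *)
Definition prepend mu (x : ipath) (xmu : irng x = src mu) : ipath :=
  sval (cid (is_prepend_ex xmu)).

Lemma prependP mu x (xmu : irng x = src mu) : is_prepend mu x (prepend xmu).
Proof. exact: (svalP (cid (is_prepend_ex xmu))). Qed.

Definition path_equiv xi eta : Prop :=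
  src xi = src eta /\
  forall (x : ipath) (hxi : irng x = src xi) (heta : irng x = src eta),
    prepend hxi = prepend heta.

Definition Per : set (groth P) :=
  [set g | exists xi eta, path_equiv xi eta /\
    g = togroth (deg L xi) - togroth (deg L eta)].

Definition Sigma_at v : set (P * P) :=
  [set mn | forall x : ipath, irng x = v -> sigma mn.1 x = sigma mn.2 x].

Definition Sigma : set (P * P) := \bigcup_(v in vertices L) Sigma_at v.

End InfinitePaths.

(* Main.v *)
Require Import Defs.
From mathcomp Require Import all_boot all_order all_algebra.
From mathcomp Require Import boolp classical_sets.

(** If [xi ~ eta] and [m + d(eta) = n + d(xi)], then every [x] with range
    [s(xi)] satisfies [sigma^m x = sigma^(m + d(eta)) (eta x) =
    sigma^(n + d(xi)) (xi x) = sigma^n x].  Conversely, let [(m, n)] be in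
    [Sigma_v], let [alpha] have range [v] and degree [m + n], and write
    [alpha = xi zeta = eta zeta'] with [d(xi) = m] and [d(eta) = n].  For [y]
    with range [s(alpha)], applying [(m, n)] to [w = alpha y] gives
    [sigma^n w = sigma^m w = zeta y], so [xi zeta y = w = eta zeta y]: hence
    [xi zeta ~ eta zeta].  That [eta zeta] is composable is seen on one such [y],
    whose existence uses that [P] has a cofinal sequence [k e], where [e] is
    the sum of a finite set of generators. *)

Set Implicit Arguments.
Unset Strict Implicit.
Unset Printing Implicit Defensive.

Import GRing.Theory.
(* Again, so that [comp] and [compA] refer to small categories. *)
Import Defs.
Local Open Scope ring_scope.
Local Open Scope classical_set_scope.

Lemma fgc_cofinal (P : fgcMonoidType) :
  exists e : P, forall p, exists k r, e *+ k = p + r.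
Proof.
have [gs gsP] := @fg_gens P.
exists (\sum_(i < size gs) gs`_i) => p; have [c ->] := gsP p.
(* The multiple [k] is the sum of all coefficients of [p]; it bounds each [c i], so the truncated
   subtractions in [r] are exact. *)
exists (\sum_i c i)%N, (\sum_(i < size gs) gs`_i *+ (\sum_j c j - c i)%N).
rewrite -sumrMnl -big_split /=; apply: eq_bigr => i _.
by rewrite -mulrnDr subnKC// (bigD1 i)//= leq_addr.
Qed.

Section PathSpace.
Variables (P : fgcMonoidType) (L : pgraph P).
Implicit Types (p q r m n : P) (v mu nu xi eta zeta : L) (x y : ipath L).

(** The value of a path at [w] is the complement of its segment at [om1 w] in its segment at
    [om2 w], and complements are unique by factorization. *)
Lemma ipath_eq0 x y : (forall p, x (om0 p) = y (om0 p)) -> x = y.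
Proof.
move=> xy; apply: ipath_eq => w.
have [e1 c1] := ipath_comp0 x w; have [e2 c2] := ipath_comp0 y w.
have [] // := factor_uniq e1 e2.
- by rewrite xy.
- by rewrite !ipath_deg.
- by rewrite -c1 -c2 xy.
Qed.

(** The complements of [Z p] in [Z (p + r)] are unique, which makes them compatible with
    composition; they are the values of the path. *)
Lemma ipath_of_segments (Z : P -> L) : (forall p, deg L (Z p) = p) ->
    (forall p r, exists z, src (Z p) = rng z /\ Z (p + r) = comp (Z p) z) ->
  exists x : ipath L, forall p, x (om0 p) = Z p.
Proof.
move=> dZ segZ.
have seg (w : Omega P) : exists z : L,
    src (Z (om1 w)) = rng z /\ Z (om2 w) = comp (Z (om1 w)) z.
  by rewrite om_diffP; exact: segZ.
have [Y YP] := choice seg.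
have rY w : src (Z (om1 w)) = rng (Y w) by have [] := YP w.
have ZY w : Z (om2 w) = comp (Z (om1 w)) (Y w) by have [] := YP w.
(* Cancellation in [P] forces the degree of the complement. *)
have dY w : deg L (Y w) = deg (Omega P) w.
  apply: (@addpI P (om1 w)); rewrite -[in LHS](dZ (om1 w)).
  by rewrite -deg_comp// -ZY dZ om_diffP.
have sY w : src (Z (om2 w)) = src (Y w) by rewrite ZY src_comp.
have uY (w : Omega P) (z : L) : src (Z (om1 w)) = rng z ->
    Z (om2 w) = comp (Z (om1 w)) z -> Y w = z.
  move=> rz E; have [] // := factor_uniq (rY w) rz.
  - by apply: (@addpI P (deg L (Z (om1 w)))); rewrite -!deg_comp// -ZY -E.
  - by rewrite -ZY.
have idY p : Y (om_id p) = src (Z p) by apply: uY; rewrite ?rng_src ?comp_src.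
have Y1 (w : Omega P) : Y (rng w) = rng (Y w) by rewrite idY rY.
have Y2 (w : Omega P) : Y (src w) = src (Y w) by rewrite idY sY.
have Y3 (w w' : Omega P) : src w = rng w' -> Y (comp w w') = comp (Y w) (Y w').
  move=> ww'; have e := (om_src_rng w w').1 ww'.
  have cY : src (Y w) = rng (Y w') by rewrite -Y2 ww' Y1.
  apply: uY.
  - by rewrite om_comp1 rng_comp// rY.
  - by rewrite om_comp1 om_comp2// ZY -e ZY compA.
exists (IPath (ipath_functor := @Functor (Omega P) L Y Y1 Y2 Y3) dY) => p /=.
have [_ s0] := vertexE (dZ 0).
have r0 : rng (Y (om0 p)) = Z 0 by rewrite -rY.
by rewrite -[LHS]comp_rng r0; exact: esym (ZY (om0 p)).
Qed.

(** Appending morphisms of degree [e] to [v] without end gives [A k] of degree [e *+ k]; by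
    cofinality each [p] is the degree of an initial segment of some [A k]. *)
Lemma ipath_exists v : deg L v = 0 -> exists x : ipath L, irng x = v.
Proof.
move=> dv; have [e eP] := fgc_cofinal P.
have step a : exists b : L, deg L b = e /\ src a = rng b.
  by have [b [db rb]] := source_free e (deg_src a); exists b.
have [B BP] := choice step.
pose A := fix A k := if k is k'.+1 then comp (A k') (B (A k')) else v.
have AB k : src (A k) = rng (B (A k)) by have [] := BP (A k).
have dA k : deg L (A k) = e *+ k.
  elim: k => [//|k IH] /=; rewrite deg_comp// IH mulrSr.
  by have [-> _] := BP (A k).
pose initial z k := exists z', src z = rng z' /\ A k = comp z z'.
have initial_leq z k j : (k <= j)%N -> initial z k -> initial z j.
  move=> /subnK <- iz; elim: (j - k)%N => [//|i [z' [zz' E]]].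
  rewrite addSn.
  have sz : src z' = rng (B (A (i + k))) by rewrite -AB E src_comp.
  exists (comp z' (B (A (i + k)))); split; first by rewrite rng_comp.
  by rewrite /= compA// -E.
(* Both are initial segments of [A (maxn k1 k2)], where factorization compares them. *)
have initial_uniq z1 z2 k1 k2 : deg L z1 = deg L z2 ->
    initial z1 k1 -> initial z2 k2 -> z1 = z2.
  move=> d12 /(initial_leq _ _ _ (leq_maxl k1 k2)) [z1' [s1 E1]].
  move=> /(initial_leq _ _ _ (leq_maxr k1 k2)) [z2' [s2 E2]].
  have [] // := factor_uniq s1 s2 d12; last by rewrite -E1 -E2.
  apply: (@addpI P (deg L z1)); rewrite -deg_comp// -E1 E2.
  by rewrite deg_comp// d12.
have ini p : exists z, deg L z = p /\ exists k, initial z k.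
  have [k [r kr]] := eP p.
  have [[z z'] [[/= dz _ zz' E] _]] := factorization (etrans (dA k) kr).
  by exists z; split=> //; exists k, z'.
have [Z ZP] := choice ini.
have dZ p : deg L (Z p) = p by have [] := ZP p.
have [||x xZ] := @ipath_of_segments Z.
- exact: dZ.
- move=> p r.
  have [[a z] [[/= da _ az E] _]] := factorization (dZ (p + r)).
  have [_ [k [z' [zz' Ek]]]] := ZP (p + r).
  have [_ [k' ik']] := ZP p.
  have sz : src z = rng z' by rewrite -zz' E src_comp.
  (* [a] is an initial segment of [A k], since [Z (p + r)] is one, and it has the degree of
     [Z p]. *)
  suff <- : a = Z p by exists z.
  apply: (@initial_uniq _ _ k k'); rewrite ?dZ//.
  by exists (comp z z'); rewrite rng_comp// compA// -E.
- exists x; rewrite /irng xZ.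
  have [_ [k ik]] := ZP 0.
  apply: (@initial_uniq _ _ k 0%N); rewrite ?dZ//.
  have [rv sv] := vertexE dv.
  by exists v; split=> /=; [rewrite rv sv|rewrite -{3}sv comp_src].
Qed.

Lemma sigmaD p q x : sigma p (sigma q x) = sigma (q + p) x.
Proof.
by apply: ipath_eq => w; congr (x _); apply: omega_eq; rewrite /= addrA.
Qed.

Lemma is_prepend_sigma p x : is_prepend (x (om0 p)) (sigma p x) x.
Proof.
move=> q r; rewrite deg_ipath0 => ->{q}.
pose w : Omega P := @Om P p (p + r) (ex_intro _ r erefl).
have [_ ->] := ipath_comp0 x w; congr comp.
by congr (x _); apply: omega_eq; rewrite /= ?addr0.
Qed.

Lemma irng_sigma p x : irng (sigma p x) = src (x (om0 p)).
Proof.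
by rewrite -functor_src; congr (x _); apply: omega_eq; rewrite /= addr0.
Qed.

Lemma is_prepend_initial mu x y : irng x = src mu -> is_prepend mu x y ->
  y (om0 (deg L mu)) = mu.
Proof. by move=> xmu /(_ _ 0 (esym (addr0 _))) ->; rewrite [x _]xmu comp_src. Qed.

Lemma is_prepend_irng mu x y : irng x = src mu -> is_prepend mu x y ->
  irng y = rng mu.
Proof.
by move=> xmu H; rewrite -[in RHS](is_prepend_initial xmu H) rng_ipath0.
Qed.

(** Each long enough initial segment of [y] begins with [mu]; unique factorization cancels it. *)
Lemma is_prependK mu x y : irng x = src mu -> is_prepend mu x y ->
  sigma (deg L mu) y = x.
Proof.
move=> xmu muxy; apply: ipath_eq0 => p.
have := @is_prepend_sigma (deg L mu) y; rewrite (is_prepend_initial xmu muxy).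
move=> /(_ _ p erefl); rewrite (muxy _ p erefl) => /esym E.
have [] // := factor_uniq _ _ erefl _ E; last by rewrite !deg_ipath0.
- by rewrite rng_ipath0 irng_sigma (is_prepend_initial xmu muxy).
- by rewrite rng_ipath0 xmu.
Qed.

Lemma is_prepend_comp mu nu x y z : src mu = rng nu -> irng x = src nu ->
  is_prepend nu x y -> is_prepend mu y z -> is_prepend (comp mu nu) x z.
Proof.
move=> munu xnu Hy Hz p r ->; rewrite deg_comp// -addrA (Hz _ _ erefl).
by rewrite (Hy _ _ erefl) compA// rng_ipath0.
Qed.

(** By uniqueness [z] is [mu (nu x)], and the shift by the degree of [mu] leaves [nu x]. *)
Lemma is_prepend_compl mu nu x z : src mu = rng nu -> irng x = src nu ->
    is_prepend (comp mu nu) x z ->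
  z (om0 (deg L mu)) = mu /\ is_prepend nu x (sigma (deg L mu) z).
Proof.
move=> munu xnu Hz; have [y Hy] := is_prepend_ex xnu.
have ymu : irng y = src mu by rewrite (is_prepend_irng xnu Hy).
have [z' Hz'] := is_prepend_ex ymu.
have <- : z' = z by apply: (is_prepend_uniq _ Hz); exact: is_prepend_comp Hz'.
by rewrite (is_prependK ymu Hz') (is_prepend_initial ymu Hz').
Qed.

Lemma Sigma_path_equiv xi eta m n : path_equiv xi eta ->
  m + deg L eta = n + deg L xi -> Sigma_at (src xi) (m, n).
Proof.
move=> [sxe E] mn x hxi /=.
have heta : irng x = src eta by rewrite -sxe.
have := is_prependK hxi (prependP hxi); rewrite (E x hxi heta) => Kxi.
have Keta := is_prependK heta (prependP heta).
(* With [y] the common path [xi x = eta x], [x] is the shift of [y] by [deg L eta] on the left and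
   by [deg L xi] on the right. *)
by rewrite -[in LHS]Keta -[in RHS]Kxi !sigmaD addrC mn addrC.
Qed.

Lemma path_equiv_Sigma v m n : deg L v = 0 -> Sigma_at v (m, n) ->
  exists xi eta, path_equiv xi eta /\ m + deg L eta = n + deg L xi.
Proof.
move=> dv Smn; have [alpha [da ra]] := source_free (m + n) dv.
have [[xi zeta] [[/= dxi dzeta xz Exi] _]] := factorization da.
have da' : deg L alpha = n + m by rewrite da addrC.
have [[eta zeta'] [[/= deta _ ez' Eeta] _]] := factorization da'.
have sa : src alpha = src zeta by rewrite Exi src_comp.
have sa' : src alpha = src zeta' by rewrite Eeta src_comp.
(* The splitting through [eta] shows that [w] starts with [eta], the one through [xi] that
   [sigma m w] is [zeta y]; [Smn] replaces [m] by [n]. *)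
have key y w : irng y = src alpha -> is_prepend alpha y w ->
    [/\ src eta = irng (sigma n w), w (om0 n) = eta
      & is_prepend zeta y (sigma n w)].
  move=> ya Hw; have wv : irng w = v by rewrite (is_prepend_irng ya Hw).
  have [] := @is_prepend_compl eta zeta' y w; rewrite -?sa' -?Eeta// deta.
  move=> weta _; split=> //; first by rewrite irng_sigma weta.
  rewrite -(Smn w wv) /= -dxi.
  by have [] := @is_prepend_compl xi zeta y w; rewrite -?sa -?Exi.
have ez : src eta = rng zeta.
  have [y ya] := ipath_exists (deg_src alpha); have [w Hw] := is_prepend_ex ya.
  have [-> _ Hz] := key y w ya Hw.
  by apply: is_prepend_irng Hz; rewrite ya.
exists alpha, (comp eta zeta); split; last first.
  (* The two degrees are [m + n] and [n + n]. *)
  by rewrite deg_comp// da deta dzeta addrCA.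
split=> [|y ha he]; first by rewrite src_comp.
have [_ weta Hz] := key _ _ ha (prependP ha).
apply: (is_prepend_uniq _ (prependP he)).
apply: is_prepend_comp Hz _ => //; first by rewrite -sa.
(* Here [w] is recovered from its segment [eta] of degree [n] and its tail [sigma n w]. *)
by rewrite -{1}weta; exact: is_prepend_sigma.
Qed.

End PathSpace.

Theorem theorem4p3 (P : fgcMonoidType) (L : pgraph P) (m n : P) :
  Sigma L (m, n) <-> Per L (togroth m - togroth n)%R.
Proof.
split=> [[v /= dv /(path_equiv_Sigma dv)[xi [eta [xe mn]]]]|[xi [eta [xe]]]].
  exists xi, eta; split=> //; rewrite -!grdiffB; apply/grdiff_eq.
  by rewrite mn addrC.
rewrite -!grdiffB => /grdiff_eq mn; exists (src xi); first exact: deg_src.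
by apply: Sigma_path_equiv xe _; rewrite mn addrC.
Qed.
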